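(* Let $\{K_m\}_{m\ge1}$ be a sequence of convex bodies in $\mathbb{R}^n$ converging in the Hausdorff metric to a convex body $K\subset\mathbb{R}^n$. Then $$\lim_{m\to\infty}\mathcal{C}(K_m)=\mathcal{C}(K).$$
   Context: A convex body in $\mathbb{R}^n$ is a compact convex set with nonempty interior; $|K|$ is Lebesgue measure. The covariance matrix $\mathrm{Cov}(K)$ is the $n\times n$ matrix with entries $\mathrm{Cov}(K)_{ij}=\int_K x_ix_j\frac{dx}{|K|}-\int_K x_i\frac{dx}{|K|}\int_K x_j\frac{dx}{|K|}$, and $\mathcal{C}(K)=\frac{|K|^2}{\det\mathrm{Cov}(K)}$. The Hausdorff distance is $d_H(A,B)=\inf\{r>0: A\subset B+rB_2^n\text{ and }B\subset A+rB_2^n\}$, with $B_2^n$ the closed Euclidean unit ball. *)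

(* Defs.v *)
From HB Require Import structures.
From mathcomp Require Import all_boot all_order all_algebra.
From mathcomp Require Import all_classical all_reals all_analysis.

Set Implicit Arguments.
Unset Strict Implicit.
Unset Printing Implicit Defensive.

Import Order.TTheory GRing.Theory Num.Theory.
Import numFieldNormedType.Exports.

Local Open Scope classical_set_scope.
Local Open Scope ring_scope.

(* R^n is 'rV[R]_n. It has the topology of the library; its sigma-algebra is
   the product one (the smallest that makes the coordinates measurable), as
   the library does for n.-tuple T. *)
Definition measure_rV_display : measure_display -> measure_display.
Proof. exact. Qed.

Section measurable_rV.
Context {d : measure_display} {T : sigmaRingType d}.
Variable n : nat.

Let coors : 'I_n -> 'rV[T]_n -> T := fun i x => x ord0 i.

Let rV_set0 : g_sigma_preimage coors set0.
Proof. exact: sigma_algebra0. Qed.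

Let rV_setC A : g_sigma_preimage coors A -> g_sigma_preimage coors (~` A).
Proof. exact: sigma_algebraC. Qed.

Let rV_bigcup (F : _^nat) : (forall i, g_sigma_preimage coors (F i)) ->
  g_sigma_preimage coors (\bigcup_i (F i)).
Proof. exact: sigma_algebra_bigcup. Qed.

HB.instance Definition _ := @isMeasurable.Build (measure_rV_display d)
  'rV[T]_n (g_sigma_preimage coors) rV_set0 rV_setC rV_bigcup.

End measurable_rV.

Lemma measurable_coord (d : measure_display) (T : sigmaRingType d) n
    (i : 'I_n) : measurable_fun setT (fun x : 'rV[T]_n => x ord0 i).
Proof.
move=> _ Y mY; rewrite setTI; apply: sub_sigma_algebra => /=.
rewrite -bigcup_seq/=; exists i => /=; first by rewrite mem_index_enum.
by exists Y => //; rewrite setTI.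
Qed.

Lemma measurable_fun_rV (d d' : measure_display) (T : measurableType d)
    (T' : measurableType d') n (f : T' -> 'rV[T]_n) :
  (forall i, measurable_fun setT (fun x => f x ord0 i)) -> measurable_fun setT f.
Proof.
move=> mf _ B mB; rewrite setTI.
suff: @measurable _ 'rV[T]_n `<=` [set A | measurable (f @^-1` A)] by exact.
apply: smallest_sub.
- split => /=.
  + by rewrite preimage_set0.
  + by move=> A mA; rewrite setTD preimage_setC; exact: measurableC.
  + by move=> F mF; rewrite preimage_bigcup; exact: bigcupT_measurable.
- move=> A; rewrite -bigcup_seq/= => -[i _ [C mC <-]]; rewrite !setTI /=.
  by have := mf i measurableT _ mC; rewrite setTI.
Qed.

Section lebesgue_rV.
Context {R : realType}.

Definition rV_cons n (p : measurableTypeR R * 'rV[R]_n) : 'rV[R]_n.+1 :=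
  \row_i oapp (p.2 ord0) p.1 (unlift ord0 i).

Definition rV_uncons n (x : 'rV[R]_n.+1) : measurableTypeR R * 'rV[R]_n :=
  (x ord0 ord0, \row_i x ord0 (lift ord0 i)).

Lemma rV_consK n : cancel (@rV_cons n) (@rV_uncons n).
Proof.
move=> [a x]; congr pair; first by rewrite mxE unlift_none.
by apply/rowP => i; rewrite !mxE liftK.
Qed.

Lemma measurable_rV_cons n : measurable_fun setT (@rV_cons n).
Proof.
apply: measurable_fun_rV => i; case: (unliftP ord0 i) => [j|] ->.
- rewrite (_ : (fun _ => _) = fun p : measurableTypeR R * 'rV[R]_n => p.2 ord0 j).
    exact: (measurableT_comp (measurable_coord j)).
  by apply/funext => p; rewrite mxE liftK.
- rewrite (_ : (fun _ => _) = fst)//.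
  by apply/funext => p; rewrite mxE unlift_none.
Qed.

Lemma measurable_rV_uncons n : measurable_fun setT (@rV_uncons n).
Proof.
apply/measurable_fun_pair; first exact: measurable_coord.
apply: measurable_fun_rV => i.
rewrite (_ : (fun _ => _) = fun x : 'rV[R]_n.+1 => x ord0 (lift ord0 i)).
  exact: measurable_coord.
by apply/funext => x; rewrite mxE.
Qed.

Lemma rV_unconsK n : cancel (@rV_uncons n) (@rV_cons n).
Proof.
move=> x; apply/rowP => i; rewrite !mxE.
by case: (unliftP ord0 i) => [j|] -> /=; rewrite ?mxE.
Qed.

Section push_cons.
Variables (n : nat) (mu : {sigma_finite_measure set 'rV[R]_n -> \bar R}).

Definition push_cons : set 'rV[R]_n.+1 -> \bar R :=
  pushforward (lebesgue_measure \x mu)%E (@rV_cons n).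

Let push_cons0 : push_cons set0 = 0%E.
Proof. by rewrite /push_cons /pushforward preimage_set0 measure0. Qed.

Let push_cons_ge0 A : (0 <= push_cons A)%E.
Proof. exact: (@measure_ge0 _ _ _ (lebesgue_measure \x mu)%E). Qed.

Let push_cons_sigma_additive : semi_sigma_additive push_cons.
Proof.
move=> F mF tF mUF.
have mc A : measurable A -> measurable (@rV_cons n @^-1` A).
  by move=> mA; rewrite -[X in measurable X]setTI; exact: measurable_rV_cons.
rewrite /push_cons /pushforward preimage_bigcup.
apply: (@measure_semi_sigma_additive _ _ _ (lebesgue_measure \x mu)%E).
- by move=> k; exact: mc.
- apply/trivIsetP => /= i j _ _ ij; rewrite -preimage_setI.
  by move/trivIsetP : tF => /(_ _ _ _ _ ij) ->//; rewrite preimage_set0.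
- by rewrite -preimage_bigcup; exact: mc.
Qed.

HB.instance Definition _ := isMeasure.Build _ _ _ push_cons
  push_cons0 push_cons_ge0 push_cons_sigma_additive.

Let push_cons_sigma_finite : sigma_finite setT push_cons.
Proof.
have /sigma_finiteP[F [TF ndF Foo]] := sigma_finiteT (@lebesgue_measure R).
have /sigma_finiteP[G [TG ndG Goo]] := sigma_finiteT mu.
exists (fun k => @rV_uncons n @^-1` (F k `*` G k)).
  apply/esym; rewrite -subTset => x _.
  have : [set: measurableTypeR R] (rV_uncons x).1 by [].
  have : [set: 'rV[R]_n] (rV_uncons x).2 by [].
  rewrite TF TG => -[k _ Gk] [j _ Fj]; exists (maxn j k) => //; split.
    by move: Fj; exact/subsetPset/ndF/leq_maxl.
  by move: Gk; exact/subsetPset/ndG/leq_maxr.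
move=> k; have [mFk Fk] := Foo k; have [mGk Gk] := Goo k; split.
  rewrite -[X in measurable X]setTI; apply: measurable_rV_uncons => //.
  exact: measurableX.
rewrite /push_cons /pushforward -comp_preimage.
rewrite (_ : _ \o _ = id) ?preimage_id; last first.
  by apply/funext => p; exact: rV_consK.
by rewrite product_measure1E// lte_mul_pinfty// ge0_fin_numE.
Qed.

HB.instance Definition _ := Measure_isSigmaFinite.Build _ _ _ push_cons
  push_cons_sigma_finite.

End push_cons.

(* Lebesgue measure on R^n: the n-fold product of the Lebesgue measure on R;
   in dimension 0 it is the unit mass of the only point. *)
Fixpoint lebesgue_rV (n : nat) : {sigma_finite_measure set 'rV[R]_n -> \bar R} :=
  if n is m.+1 then push_cons (lebesgue_rV m) : {sigma_finite_measure set _ -> \bar R}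
  else \d_(0 : 'rV[R]_0).

Lemma lebesgue_rV_box n (A : 'I_n -> set R) : (forall i, measurable (A i)) ->
  lebesgue_rV n [set x | forall i, A i (x ord0 i)] =
  (\prod_(i < n) lebesgue_measure (A i))%E.
Proof.
elim: n A => [|n IHn] A mA.
  rewrite big_ord0 /= diracE (_ : (_ \in _) = true)//.
  by apply/mem_set => -[].
rewrite big_ord_recl -IHn; last by move=> i; exact: mA.
rewrite -product_measure1E; [|exact: mA|]; last first.
  rewrite [X in measurable X](_ : _ =
      \bigcap_(i in [set: 'I_n]) ((fun x : 'rV[R]_n => x ord0 i) @^-1` A (lift ord0 i))).
    apply: fin_bigcap_measurable => // i _.
    by rewrite -[X in measurable X]setTI; exact: measurable_coord.
  by apply/seteqP; split=> [x /= xA i _|x /= xA i]; exact: xA.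
rewrite /= /push_cons /pushforward; congr (product_measure1 _ _ _).
apply/seteqP; split=> [[a x] /= xA|[a x] /= [aA xA] i].
  split=> [|i]; first by have := xA ord0; rewrite mxE unlift_none.
  by have := xA (lift ord0 i); rewrite mxE liftK.
by rewrite mxE; case: (unliftP ord0 i) => [j|] ->.
Qed.

End lebesgue_rV.

Section convex_bodies.
Context {R : realType} {n : nat}.
Implicit Types A B K : set 'rV[R]_n.

Definition convex_body K := [/\ compact K, convex_set K & K° !=set0].

Definition volume K : R := fine (lebesgue_rV n K).

Definition covariance_mx K : 'M[R]_n := \matrix_(i, j)
  (\int[lebesgue_rV n]_(x in K) (x ord0 i * x ord0 j / volume K)
   - (\int[lebesgue_rV n]_(x in K) (x ord0 i / volume K))
     * (\int[lebesgue_rV n]_(x in K) (x ord0 j / volume K))).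

Definition cov_functional K : R := volume K ^+ 2 / \det (covariance_mx K).

(* The library's norm on 'rV[R]_n is the sup norm. *)
Definition euclidean_ball : set 'rV[R]_n :=
  [set x | Num.sqrt (\sum_(i < n) x ord0 i ^+ 2) <= 1].

Definition thicken A (r : R) : set 'rV[R]_n :=
  [set a + r *: b | a in A & b in euclidean_ball].

(* inf is 0 on the empty set, but some r qualifies as soon as A and B are
   nonempty and bounded. *)
Definition hausdorff_dist A B : R :=
  inf [set r | [/\ 0 < r, A `<=` thicken B r & B `<=` thicken A r]].

End convex_bodies.

(* Main.v *)
Require Import Defs.
From mathcomp Require Import all_boot all_order all_algebra.
From mathcomp Require Import all_classical all_reals all_analysis.
From mathcomp Require Import measurable_realfun.
From mathcomp Require Import ring lra.

Set Implicit Arguments.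
Unset Strict Implicit.
Unset Printing Implicit Defensive.

Import Order.TTheory GRing.Theory Num.Theory.
Import numFieldNormedType.Exports.

Local Open Scope classical_set_scope.
Local Open Scope ring_scope.

(** Write [mu] for Lebesgue measure. The functional is a continuous expression
    in the integrals over the body of the functions [1], [x_i] and [x_i x_j],
    so two facts are enough: these integrals converge, and the covariance
    matrix of the limit body is invertible.

    Convergence of the integrals of any continuous [g]
    ([cvg_Rintegral_hausdorff]) is dominated convergence for [g] times the
    indicators of [K_m], all of which eventually live in a fixed compact cube.
    The indicators converge at every point off the boundary of [K]. A point
    outside the closed set [K] is at a positive distance from it, hence is
    eventually outside [K_m] ([fatten_exterior]). For an interior point the
    argument needs convexity of [K_m]: if it were not in [K_m], moving it a
    little away from its projection on [K_m] would give a point of [K] too far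
    from [K_m] ([fatten_interior]).

    The boundary of a convex body is null ([convex_body_boundary]). The measure
    being an iterated product, this goes by induction on the dimension, slicing
    along the first coordinate. If a slice meets the interior of the body, it is
    a convex body whose boundary contains the slice of the boundary
    ([slice_boundary]), so that slice is null by induction. At most two
    nonempty slices, the extreme ones, miss the interior
    ([slice_meets_interior]).

    Invertibility ([det_covariance_mx_neq0]) holds since the quadratic form of
    the covariance matrix at [v] is the variance of the linear form [v] on the
    body, and a nonzero linear form is not constant on a nonempty open set. *)

(** * Neighbourhoods, convexity and measurability of row vectors *)

Lemma convex_comb (R : realType) n (A : set 'rV[R]_n) (x y : 'rV[R]_n) (t : R) :
  convex_set A -> A x -> A y -> 0 <= t <= 1 -> A (t *: x + (1 - t) *: y).
Proof.
move=> cA Ax Ay /andP[t0 t1].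
by have /set_mem := cA x y (Itv01 t0 t1) (mem_set Ax) (mem_set Ay).
Qed.

Lemma ball_rVP (R : realType) n (x y : 'rV[R]_n) (e : R) :
  0 < e -> ball x e y <-> forall i, `|x ord0 i - y ord0 i| < e.
Proof.
move=> e0; split=> [[_ + i]|xy]; first exact.
by split => // i j; rewrite (ord1 i); exact: xy.
Qed.

Lemma interior_rVP (R : realType) n (A : set 'rV[R]_n) (x : 'rV[R]_n) :
  A° x <-> exists2 e : R, 0 < e & ball x e `<=` A.
Proof. by split=> /nbhs_ballP[e e0 eA]; exists e. Qed.

Lemma coord_le_norm (R : realType) n (x : 'rV[R]_n) (i : 'I_n) :
  `|x ord0 i| <= `|x|.
Proof.
rewrite [leRHS]/Num.norm /= mx_normrE; apply/bigmax_geP; right => /=.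
by exists (ord0, i).
Qed.

(** A ball of radius e around x, contracted towards y by the factor t, is a ball
    of radius t e which convexity keeps inside the set. *)
Lemma interior_convex_comb (R : realType) n (A : set 'rV[R]_n)
    (x y : 'rV[R]_n) (t : R) :
  convex_set A -> A° x -> A y -> 0 < t <= 1 -> A° (t *: x + (1 - t) *: y).
Proof.
move=> cA /interior_rVP[e e0 eA] Ay /andP[t0 t1]; apply/interior_rVP.
exists (t * e); first exact: mulr_gt0.
move=> z; rewrite (ball_rVP _ _ (mulr_gt0 t0 e0)) => hz.
pose w := t^-1 *: (z - (1 - t) *: y).
have -> : z = t *: w + (1 - t) *: y.
  by rewrite /w scalerA divff ?gt_eqF// scale1r subrK.
apply: convex_comb => //; last by rewrite (ltW t0).
apply: eA; apply/ball_rVP => // i; have := hz i; rewrite !mxE.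
set a := x _ _; set b := y _ _; set c := z _ _.
have -> : t * a + (1 - t) * b - c = t * (a - t^-1 * (c - (1 - t) * b)).
  by field; rewrite gt_eqF.
by rewrite normrM gtr0_norm// ltr_pM2l.
Qed.

(** The open cubes with rational centre and radius 1/(k+1) form a countable
    base of the topology. *)
Lemma open_measurable_rV (R : realType) n (A : set 'rV[R]_n) :
  open A -> measurable A.
Proof.
move=> oA.
pose c (q : 'rV[rat]_n) (k : nat) : set 'rV[R]_n :=
  ball (\row_i ratr (q ord0 i) : 'rV[R]_n) k.+1%:R^-1.
have mc q k : measurable (c q k).
  rewrite (_ : c q k = \bigcap_(i in [set: 'I_n])
     ((fun x : 'rV[R]_n => x ord0 i) @^-1` ball (ratr (q ord0 i) : R) k.+1%:R^-1)).
    apply: fin_bigcap_measurable => // i _.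
    rewrite -[X in measurable X]setTI; apply: measurable_coord => //.
    by apply: open_measurable; apply: ball_open; rewrite invr_gt0.
  apply/seteqP; split=> x.
    by move=> /ball_rVP cx i _; have /= := cx ltac:(by []) i; rewrite mxE.
  by move=> cx; apply/ball_rVP => // i; have := cx i; rewrite mxE; exact.
rewrite (_ : A = \bigcup_(p in [set p : 'rV[rat]_n * nat |
    c p.1 p.2 `<=` A]) c p.1 p.2).
  rewrite bigcup_mkcond; apply: countable_bigcupT_measurable => // p.
  by case: ifP.
apply/seteqP; split=> [x Ax|x [p /= cA cx]]; last exact: cA.
have /interior_rVP[e e0 eA] : A° x by move: oA; rewrite openE; exact.
have [k /= ke] : exists k, k.+1%:R^-1 < e / 2.
  have e20 : 0 < e / 2 by rewrite divr_gt0.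
  have [N _ /(_ N (leqnn N)) /=] := near_infty_natSinv_lt (PosNum e20).
  by exists N.
have k0 : 0 < k.+1%:R^-1 :> R by rewrite invr_gt0.
have qx i : {q : rat | `|ratr q - x ord0 i| < k.+1%:R^-1}.
  apply: cid; have [q] := @rat_in_itvoo R
    (x ord0 i - k.+1%:R^-1) (x ord0 i + k.+1%:R^-1)
    ltac:(by rewrite ltrD2l gtrN).
  by rewrite in_itv/= => xq; exists q; rewrite distrC ltr_distlC.
exists (\row_i sval (qx i), k) => /=; last first.
  by apply/ball_rVP => // i; rewrite !mxE; exact: (svalP (qx i)).
move=> y /ball_rVP cy; apply: eA; apply/ball_rVP => // i.
have := cy k0 i; have := svalP (qx i); rewrite !mxE.
set a := ratr _; set u := x _ _; set v := y _ _ => h1 h2.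
have -> : u - v = - (a - u) + (a - v) by ring.
rewrite (le_lt_trans (ler_normD _ _))// normrN (splitr e).
by rewrite ltrD ?(lt_trans h1) ?(lt_trans h2).
Qed.

Lemma compact_measurable_rV (R : realType) n (A : set 'rV[R]_n) :
  compact A -> measurable A.
Proof.
move=> /compact_closed => /(_ (@norm_hausdorff _ _)) /closed_openC.
by move=> /open_measurable_rV /measurableC; rewrite setCK.
Qed.

Lemma continuous_measurable_rV (R : realType) n (f : 'rV[R]_n -> R) :
  continuous f -> measurable_fun setT f.
Proof.
move=> /continuousP cf; apply: (measurability _ (RGenOpens.measurableE R)).
move=> _ [_ [a [b ->] <-]]; rewrite setTI; apply: open_measurable_rV.
exact/cf/interval_open.
Qed.

(** * The boundary of a convex body is null *)

Lemma lebesgue_rV_ball (R : realType) n (x : 'rV[R]_n) (e : R) : 0 < e ->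
  lebesgue_rV n (ball x e) = ((e *+ 2) ^+ n)%:E.
Proof.
move=> e0.
rewrite (_ : ball x e = [set y | forall i, ball (x ord0 i) e (y ord0 i)]); last first.
  by apply/seteqP; split=> y /(ball_rVP _ _ e0).
rewrite (lebesgue_rV_box (A := fun i => ball (x ord0 i) e)); last first.
  by move=> i; apply: open_measurable; exact: ball_open.
rewrite (eq_bigr (fun=> (e *+ 2)%:E)); last first.
  by move=> i _; rewrite lebesgue_measure_ball// ltW.
by rewrite prodEFin prodr_const card_ord.
Qed.

Section slice.
Variables (R : realType) (n : nat).
Implicit Types (A : set 'rV[R]_n.+1) (a : R) (y : 'rV[R]_n).

Definition slice a A : set 'rV[R]_n := [set y | A (rV_cons (a, y))].

Lemma ball_rV_cons a y y' (e : R) : 0 < e ->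
  ball (rV_cons (a, y)) e (rV_cons (a, y')) <-> ball y e y'.
Proof.
move=> e0; split=> /(ball_rVP _ _ e0) h; apply/ball_rVP => // i.
  by have := h (lift ord0 i); rewrite !mxE liftK.
rewrite !mxE; case: (unliftP ord0 i) => [j _|_] /=; first exact: h.
by rewrite subrr normr0.
Qed.

Lemma convex_slice a A : convex_set A -> convex_set (slice a A).
Proof.
move=> cA y y' l /set_mem yA /set_mem y'A; apply/mem_set.
have := cA _ _ l (mem_set yA) (mem_set y'A); rewrite inE /slice /=.
congr A; apply/rowP => i; rewrite !mxE.
case: (unliftP ord0 i) => [j _|_] /=; first by rewrite !mxE.
by rewrite -mulrDl addrC subrK mul1r.
Qed.

Lemma compact_slice a A : compact A -> compact (slice a A).
Proof.
move=> cA.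
pose tl (x : 'rV[R]_n.+1) : 'rV[R]_n := \row_i x ord0 (lift ord0 i).
have ctl : continuous tl.
  move=> x B /nbhs_ballP[e e0 eB]; apply/nbhs_ballP; exists e => // z.
  move=> /(ball_rVP _ _ e0) xz; apply: eB; apply/ball_rVP => // i.
  by rewrite !mxE; exact: xz.
rewrite (_ : slice a A =
    tl @` (A `&` (fun x : 'rV[R]_n.+1 => x ord0 ord0) @^-1` [set a])).
  apply: continuous_compact; first exact: continuous_subspaceT.
  apply: compact_closedI => //; apply: preimage_closed.
    by move=> x _; exact: coord_continuous.
  by apply: compact_closed; [exact: Rhausdorff|exact: compact_set1].
apply/seteqP; split=> [y Ay|_ [x [Ax /= xa] <-]]; last first.
  by rewrite /slice/= -xa -[X in A X]/(rV_cons (rV_uncons x)) rV_unconsK.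
exists (rV_cons (a, y)); first by split => //=; rewrite mxE unlift_none.
by apply/rowP => i; rewrite !mxE liftK.
Qed.

Lemma interior_slice a A y : A° (rV_cons (a, y)) -> (slice a A)° y.
Proof.
move=> /interior_rVP[e e0 eA]; apply/interior_rVP; exists e => // z yz.
by apply: eA; apply/ball_rV_cons.
Qed.

Lemma convex_body_slice a A y : convex_body A -> A° (rV_cons (a, y)) ->
  convex_body (slice a A).
Proof.
case=> cA vA _ Ay; split; [exact: compact_slice|exact: convex_slice|].
by exists y; exact: interior_slice.
Qed.

(** Let the slice meet the interior of the set at y. A point z interior to the
    slice remains in it when the segment from y to z is slightly prolonged, to w
    say; then z lies strictly between the interior point y and the point w, so
    it is interior to the whole set. *)
Lemma slice_boundary a A y : convex_set A -> A° (rV_cons (a, y)) ->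
  slice a (A `\` A°) `<=` slice a A `\` (slice a A)°.
Proof.
move=> cA Ay z [/= Az nAz]; split; first exact: Az.
move=> /interior_rVP[e e0 eA]; apply: nAz.
have [c c0 yzc] : exists2 c : R, 0 < c & forall i, c * `|z ord0 i - y ord0 i| < e.
  exists (e / (1 + `|z - y|)); first by rewrite divr_gt0// ltr_pwDl.
  move=> i; rewrite mulrAC ltr_pdivrMr ?ltr_pwDl// ltr_pM2l//.
  by have := coord_le_norm (z - y) i; rewrite !mxE; lra.
pose w := z + c *: (z - y).
have Aw : slice a A w.
  apply: eA; apply/ball_rVP => // i; rewrite !mxE.
  rewrite (_ : _ - _ = - (c * (z ord0 i - y ord0 i))); last by ring.
  by rewrite normrN normrM gtr0_norm.
have c1 : 0 < 1 + c by rewrite addr_gt0.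
pose t := c / (1 + c).
have t1 : 1 - t = (1 + c)^-1 by rewrite /t; field; rewrite gt_eqF.
have t01 : 0 < t <= 1 by rewrite /t divr_gt0// ler_pdivrMr// mul1r lerDr ler01.
have := interior_convex_comb cA Ay Aw t01.
congr (A° _); rewrite t1 /t; apply/rowP => i; rewrite !mxE.
case: (unliftP ord0 i) => [j _|_] /=; rewrite ?mxE; field; rewrite gt_eqF//.
Qed.

End slice.

(** A segment from an interior point to any point of the set consists of
    interior points, up to the endpoint, so the interior is met at every level
    that the segment crosses. *)
Lemma slice_meets_interior (R : realType) n (A : set 'rV[R]_n.+1)
    (a0 a a1 : R) x y :
  convex_set A -> A° (rV_cons (a0, x)) -> A (rV_cons (a1, y)) ->
  (a0 <= a < a1) || (a1 < a <= a0) -> exists z, A° (rV_cons (a, z)).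
Proof.
move=> cA Ax Ay aa.
have a10 : a1 - a0 != 0.
  by rewrite subr_eq0; apply: contraTneq aa => ->; apply/negP; lra.
pose t := (a1 - a) / (a1 - a0).
exists (t *: x + (1 - t) *: y).
have := @interior_convex_comb _ _ A _ _ t cA Ax Ay.
have -> : 0 < t <= 1.
  case/orP: aa => /andP[? ?].
    have ? : 0 < a1 - a0 by lra.
    by rewrite /t divr_gt0 ?ler_pdivrMr//; lra.
  have ? : 0 < a0 - a1 by lra.
  rewrite /t -mulrNN -invrN !opprB divr_gt0 ?ler_pdivrMr//; lra.
move=> /(_ isT); congr (A° _); apply/rowP => i; rewrite !mxE.
case: (unliftP ord0 i) => [j _|_] /=; rewrite ?mxE//.
by rewrite /t; field.
Qed.

(** Only the greatest and the least level of the body can be bad, that is, have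
    a nonempty slice disjoint from the interior; at all the other levels the
    induction hypothesis applies to the slice. *)
Lemma convex_body_boundary (R : realType) n (K : set 'rV[R]_n) :
  convex_body K -> lebesgue_rV n (K `\` K°) = 0%E.
Proof.
elim: n K => [|n IH] K bK.
  case: bK => _ _ [x Kx]; rewrite (_ : K `\` K° = set0) ?measure0//.
  apply/seteqP; split=> // y [_]; apply; rewrite (_ : y = x)//.
  by apply/rowP => -[].
have [cK vK [x0 Kx0]] := bK.
have mN : measurable (K `\` K°).
  apply: measurableD; first exact: compact_measurable_rV.
  by apply: open_measurable_rV; exact: open_interior.
have mN' : measurable (@rV_cons R n @^-1` (K `\` K°)).
  by rewrite -[X in measurable X]setTI; exact: measurable_rV_cons.
pose a0 := x0 ord0 ord0.
have {}Kx0 : K° (rV_cons (a0, (rV_uncons x0).2)).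
  by rewrite -[X in K° X]/(rV_cons (rV_uncons x0)) rV_unconsK.
pose bad := [set a : R | slice a K !=set0 /\ slice a K° = set0].
(* The only bad levels above and below a0, if there are any. *)
pose B1 := xget 0 (bad `&` [set a | a0 < a]).
pose B2 := xget 0 (bad `&` [set a | a < a0]).
have bad2 : bad `<=` [set B1; B2].
  have key a a' : bad a -> bad a' -> (a0 <= a < a') || (a' < a <= a0) -> False.
    move=> [_ a_] [[y a'y] _] aa'.
    have [z zK] := slice_meets_interior vK Kx0 a'y aa'.
    by have : slice a K° z by []; rewrite a_.
  move=> a ba; have [aa0|aa0|aa0] := ltgtP a a0; [right|left|].
  - have [bB B0] : (bad `&` [set a | a < a0]) B2 by apply: xgetPex; exists a.
    apply/eqP; rewrite eq_le !leNgt; apply/andP; split; apply/negP => h.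
      by apply: (key _ _ ba bB); rewrite h /= in B0 *; lra.
    by apply: (key _ _ bB ba); rewrite h /= in B0 *; lra.
  - have [bB B0] : (bad `&` [set a | a0 < a]) B1 by apply: xgetPex; exists a.
    apply/eqP; rewrite eq_le !leNgt; apply/andP; split; apply/negP => h.
      by apply: (key _ _ bB ba); rewrite h /= in B0 *; lra.
    by apply: (key _ _ ba bB); rewrite h /= in B0 *; lra.
  - case: ba => _; rewrite aa0 => h; exfalso.
    by rewrite -[False]/(set0 (rV_uncons x0).2) -h.
rewrite /= /push_cons /pushforward /product_measure1.
rewrite (@ge0_ae_eq_integral _ _ _ _ _ _ (cst 0%E)) ?integral0//=.
- exact: (measurable_fun_xsection (lebesgue_rV n)).
- exists [set B1; B2]; split.
  + by apply: measurableU; exact: measurable_set1.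
  + by apply: countable_lebesgue_measure0; exact/finite_set_countable/finite_set2.
  move=> a; apply: contra_notP => na _ /=.
  rewrite xsectionE -[X in lebesgue_rV n X]/(slice a (K `\` K°)).
  have [[y Ky]|/set0P/negP/negPn/eqP K0] := pselect (slice a K !=set0); last first.
    rewrite (_ : slice a _ = set0) ?measure0//; apply/seteqP; split=> // y [Ky _].
    by have : slice a K y by []; rewrite K0.
  have [[z Kz]|/set0P/negP/negPn/eqP K0] := pselect (slice a K° !=set0); last first.
    by exfalso; apply: na; apply: bad2; split => //; exists y.
  apply: (@subset_measure0 _ _ _ (lebesgue_rV n) _ (slice a K `\` (slice a K)°)).
  + have := measurable_xsection a mN'; rewrite xsectionE.
    exact.
  + apply: measurableD; first by apply: compact_measurable_rV; exact: compact_slice.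
    by apply: open_measurable_rV; exact: open_interior.
  + exact: slice_boundary Kz.
  + exact/IH/(convex_body_slice bK Kz).
Qed.

(** * Hausdorff closeness and membership *)

Section pointwise.
Variables (R : realType) (n : nat).
Implicit Types (A B K : set 'rV[R]_n) (x y : 'rV[R]_n).

(** Thickening by open cubes instead of closed Euclidean balls; as the unit
    cube contains the unit ball, closeness for the Hausdorff distance implies
    inclusion in these larger and simpler sets. *)
Definition fatten A (r : R) : set 'rV[R]_n :=
  [set x | exists2 y, A y & ball y r x].

Lemma thicken_fatten A (r s : R) : 0 < r -> r < s -> thicken A r `<=` fatten A s.
Proof.
move=> r0 rs _ [a Aa [b bB <-]]; exists a => //.
apply/ball_rVP => [|i]; first exact: lt_trans rs.
have b1 : `|b ord0 i| <= 1.
  have b2 : b ord0 i ^+ 2 <= \sum_(j < n) b ord0 j ^+ 2.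
    by rewrite (bigD1 i)//= lerDl sumr_ge0// => j _; exact: sqr_ge0.
  by rewrite -sqrtr_sqr (le_trans (ler_wsqrtr b2)).
rewrite !mxE opprD addNKr normrN normrM gtr0_norm//.
by rewrite (le_lt_trans _ rs)// ler_piMr// ltW.
Qed.

(** This makes the infimum that defines the Hausdorff distance of two nonempty
    bounded sets range over a nonempty set. The factor n + 1 is a crude bound of
    the Euclidean norm by the sup norm. *)
Lemma bounded_thicken A B (M : R) : 0 < M -> B !=set0 ->
  (forall x, A x -> `|x| <= M) -> (forall x, B x -> `|x| <= M) ->
  A `<=` thicken B (n.+1%:R * (M *+ 2)).
Proof.
move=> M0 [y By] AM BM x Ax; set r := _ * _.
have r0 : 0 < r by rewrite mulr_gt0// mulr2n addr_gt0.
exists y => //; exists (r^-1 *: (x - y)); last first.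
  by rewrite scalerA divff ?gt_eqF// scale1r addrC subrK.
rewrite /euclidean_ball /=.
have xy i : ((r^-1 *: (x - y)) ord0 i) ^+ 2 <= n.+1%:R^-1.
  apply: (@le_trans _ _ (n.+1%:R^-1 ^+ 2)); last first.
    by rewrite expr2 ler_piMr ?invr_ge0// invf_le1// ler1n.
  rewrite -ler_sqrt ?exprn_ge0 ?invr_ge0// !sqrtr_sqr [leRHS]ger0_norm ?invr_ge0//.
  rewrite mxE normrM gtr0_norm ?invr_gt0// ler_pdivrMl//.
  rewrite /r mulrC mulKf ?pnatr_eq0//.
  rewrite (le_trans (coord_le_norm _ _))// (le_trans (ler_normB _ _))//.
  by rewrite mulr2n; apply: lerD; [exact: AM|exact: BM].
rewrite -[leRHS]sqrtr1; apply: ler_wsqrtr.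
apply: (@le_trans _ _ (\sum_(i < n) n.+1%:R^-1)); first exact: ler_sum.
rewrite sumr_const card_ord -[_ *+ _]mulr_natr mulrC ler_pdivrMr// mul1r.
by rewrite ler_nat.
Qed.

Lemma hausdorff_dist_fatten A B (r : R) : A !=set0 -> B !=set0 ->
  compact A -> compact B -> hausdorff_dist A B < r ->
  A `<=` fatten B r /\ B `<=` fatten A r.
Proof.
move=> A0 B0 /compact_bounded/ex_strict_bound_gt0[M M0 AM].
move=> /compact_bounded/ex_strict_bound_gt0[N N0 BN] /inf_lt[|s [s0 AB BA] sr].
  exists (n.+1%:R * ((M + N) *+ 2)).
  have MN0 : 0 < M + N by exact: addr_gt0.
  have AMN x : A x -> `|x| <= M + N by move/AM/ltW/le_trans; apply; lra.
  have BMN x : B x -> `|x| <= M + N by move/BN/ltW/le_trans; apply; lra.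
  split; first by rewrite mulr_gt0// mulr2n addr_gt0.
  - exact: bounded_thicken.
  - exact: bounded_thicken.
by split=> x; [move/AB|move/BA]; exact: thicken_fatten.
Qed.

Lemma fatten_exterior K x : compact K -> ~ K x ->
  exists2 r : R, 0 < r & forall A, A `<=` fatten K r -> ~ A x.
Proof.
move=> cK nKx.
have /closed_openC oK : closed K by apply: compact_closed => //; exact: norm_hausdorff.
have /interior_rVP[e e0 eK] : (~` K)° x by move: oK; rewrite openE; exact.
exists e => // A AK /AK[y Ky yx]; apply: (eK y) => //; exact: ball_sym.
Qed.

(** The nearest point p of A to x: were the scalar product s of x - p and y - p
    positive, a short step from p towards y would come closer to x. *)
Lemma projection A x : A !=set0 -> compact A -> convex_set A ->
  exists2 p, A p & forall y, A y ->
    \sum_i (x ord0 i - p ord0 i) * (y ord0 i - p ord0 i) <= 0.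
Proof.
move=> A0 cA vA.
pose f y : R := \sum_i (x ord0 i - y ord0 i) ^+ 2.
have cf : continuous f.
  apply: (@continuous_big _ _ +%R) => [|i _]; first exact: add_continuous.
  have ci : continuous (fun y : 'rV[R]_n => x ord0 i - y ord0 i).
    move=> y; apply: (@continuousB _ _ _ (cst (x ord0 i)) (fun y : 'rV[R]_n => y ord0 i)).
      exact: cst_continuous.
    exact: coord_continuous.
  by move=> y; exact: (continuous_comp (ci y) (@exprn_continuous R 2 _)).
have [p /set_mem Ap pmin] := EVT_min_rV A0 cA (continuous_subspaceT cf).
exists p => // y Ay; rewrite leNgt; apply/negP; set s := \sum_i _ => s0.
pose q := \sum_i (y ord0 i - p ord0 i) ^+ 2.
have q0 : 0 <= q by apply: sumr_ge0 => i _; exact: sqr_ge0.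
have sq0 : 0 < s + q by rewrite ltr_pwDl.
(* The squared distance to x changes by t (t q - 2 s), and t q <= s. *)
pose t := s / (s + q).
have t0 : 0 < t by rewrite divr_gt0.
have t01 : 0 <= t <= 1 by rewrite (ltW t0) ler_pdivrMr// mul1r lerDl.
have := pmin _ (mem_set (convex_comb vA Ay Ap t01)).
have -> : f (t *: y + (1 - t) *: p) = f p + (- (t *+ 2)) * s + t ^+ 2 * q.
  rewrite /f /s /q !mulr_sumr -!big_split /=; apply: eq_bigr => i _.
  by rewrite !mxE; ring.
rewrite -addrA lerDl => h.
have {}h : s *+ 2 <= t * q.
  by rewrite -(ler_pM2l t0); lra.
have : t * q <= s by rewrite /t mulrAC ler_pdivrMr// ler_wpM2l ?(ltW s0)//; lra.
lra.
Qed.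

(** Were x outside A, with projection p on A, moving x by r in each coordinate
    in which it differs from p, away from p, would give a point z of K. Let
    u = x - p and let |u|_1 be the sum of the |u_i|. The scalar product of u
    with z - p is |u|^2 + r |u|_1, but it is at most r |u|_1 because z is within
    r, in each coordinate, of a point y of A, and the scalar product of u with
    y - p is nonpositive. *)
Lemma fatten_interior K x : K° x ->
  exists2 r : R, 0 < r & forall A, A !=set0 -> compact A -> convex_set A ->
    K `<=` fatten A r -> A x.
Proof.
move=> /interior_rVP[e e0 eK]; exists (e / 2); first exact: divr_gt0.
move=> A A0 cA vA KA; set r := e / 2; have r0 : 0 < r by exact: divr_gt0.
have [p Ap px] := projection x A0 cA vA.
pose z : 'rV[R]_n := \row_i (x ord0 i + r * Num.sg (x ord0 i - p ord0 i)).
have [y Ay /(ball_rVP _ _ r0) yz] : fatten A r z.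
  apply/KA/eK/ball_rVP => // i; rewrite mxE opprD addNKr normrN normrM gtr0_norm//.
  rewrite normr_sg; have : r < e by rewrite /r; lra.
  by apply: le_lt_trans; rewrite ler_piMr ?(ltW r0)// lern1 leq_b1.
suff xp : x = p by rewrite xp.
have : \sum_i (x ord0 i - p ord0 i) ^+ 2 <= 0.
  apply: le_trans (px _ Ay); apply: ler_sum => i _.
  have := yz i; rewrite mxE; set u := x ord0 i - p ord0 i => yzi.
  have -> : y ord0 i - p ord0 i =
      u + r * Num.sg u - (x ord0 i + r * Num.sg u - y ord0 i).
    by rewrite /u; ring.
  rewrite mulrBr mulrDr mulrCA -expr2 [u * Num.sg u]mulrC -normrEsg.
  rewrite -addrA lerDl subr_ge0.
  rewrite (le_trans (ler_norm _))// normrM mulrC ler_wpM2r// distrC.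
  exact: ltW.
move=> h; apply/rowP => i; apply/eqP; rewrite -subr_eq0 -sqrf_eq0 eq_le sqr_ge0 andbT.
by apply: le_trans h; rewrite (bigD1 i)//= lerDl sumr_ge0// => j _; exact: sqr_ge0.
Qed.

End pointwise.

(** * Convergence of integrals *)

Section integrals.
Variables (R : realType) (n : nat).
Implicit Types (A B K : set 'rV[R]_n) (g : 'rV[R]_n -> R).

Local Notation mu := (lebesgue_rV n).

Lemma compact_lebesgue_rV_lty A : compact A -> (mu A < +oo)%E.
Proof.
move=> cA; have [M M0 AM] := ex_strict_bound_gt0 (compact_bounded cA).
apply: (@le_lt_trans _ _ (mu (ball 0 M))).
  apply: le_measure; rewrite ?inE; first exact: compact_measurable_rV.
    by apply: open_measurable_rV; exact: ball_open.
  move=> x Ax; apply/ball_rVP => // i; rewrite mxE sub0r normrN.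
  exact: le_lt_trans (coord_le_norm _ _) (AM _ Ax).
by rewrite lebesgue_rV_ball// ltry.
Qed.

Lemma compact_continuous_bound A g : compact A -> continuous g ->
  exists2 M : R, 0 < M & forall x, A x -> `|g x| <= M.
Proof.
move=> cA cg.
have [M M0 gM] := ex_strict_bound_gt0 (compact_bounded
  (continuous_compact (continuous_subspaceT cg) cA)).
by exists M => // x Ax; apply/ltW/gM; exists x.
Qed.

Lemma continuous_integrable_rV A g : compact A -> continuous g ->
  mu.-integrable A (EFin \o g).
Proof.
move=> cA cg; apply: measurable_bounded_integrable.
- exact: compact_measurable_rV.
- exact: compact_lebesgue_rV_lty.
- by apply: measurable_funTS; exact: continuous_measurable_rV.
- have [M _ gM] := compact_continuous_bound cA cg.
  by exists M; split; [exact: num_real|move=> N /ltW MN x /gM /le_trans; exact].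
Qed.

Lemma Rintegral_gt0 A g (x : 'rV[R]_n) : compact A -> continuous g ->
  (forall y, A y -> 0 <= g y) -> A° x -> 0 < g x -> 0 < \int[mu]_(y in A) g y.
Proof.
move=> cA cg g0 Ax gx.
have gx2 : 0 < g x / 2 by rewrite divr_gt0.
have /nbhs_ballP[e /= e0 eA] : \forall y \near x, A y /\ g x / 2 < g y.
  apply: filterI; first exact: Ax.
  have gxx : g x / 2 < g x by rewrite ltr_pdivrMr// ltr_pMr// ltr1n.
  exact: cg _ (lt_nbhsr gxx).
have mA := compact_measurable_rV cA.
have mB : measurable (ball x e) by apply: open_measurable_rV; exact: ball_open.
have mg D : measurable_fun D (EFin \o g).
  by apply/measurable_EFinP; apply: measurable_funTS; exact: continuous_measurable_rV.
have fin := integrable_fin_num mA (continuous_integrable_rV cA cg).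
rewrite -lte_fin fineK//.
apply: (@lt_le_trans _ _ (\int[mu]_(y in ball x e) (g x / 2)%:E)%E).
  rewrite integral_cst// (_ : (_ * _)%E = (g x / 2 * (e *+ 2) ^+ n)%:E).
    by rewrite lte_fin mulr_gt0// exprn_gt0// mulrn_wgt0.
  by rewrite [RHS]EFinM -(lebesgue_rV_ball x).
apply: (@le_trans _ _ (\int[mu]_(y in ball x e) (g y)%:E)%E).
  apply: ge0_le_integral => //=.
  - by move=> y _; rewrite lee_fin ltW.
  - by move=> y /eA[_ gy]; rewrite lee_fin; exact: ltW.
by apply: ge0_subset_integral => // y /eA[].
Qed.

Lemma volumeE K : convex_body K -> volume K = \int[mu]_(x in K) cst 1 x.
Proof.
by case=> cK _ _; rewrite Rintegral_cst ?mul1r//; exact: compact_measurable_rV.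
Qed.

Lemma volume_gt0 K : convex_body K -> 0 < volume K.
Proof.
move=> bK; rewrite volumeE//; have [cK _ [x Kx]] := bK.
exact: (Rintegral_gt0 cK (@cst_continuous _ _ _) (fun _ _ => ler01) Kx ltr01).
Qed.

Section hausdorff_limit.
Variables (K_ : nat -> set 'rV[R]_n) (K : set 'rV[R]_n).
Hypotheses (convexK_ : forall m, convex_body (K_ m)) (convexK : convex_body K).
Hypothesis cvgK : hausdorff_dist (K_ m) K @[m --> \oo] --> (0 : R).

Lemma near_hausdorff_fatten (r : R) : 0 < r ->
  \forall m \near \oo, K_ m `<=` fatten K r /\ K `<=` fatten (K_ m) r.
Proof.
move=> r0; have : \forall m \near \oo, hausdorff_dist (K_ m) K < r.
  exact: (cvgr_lt _ cvgK).
apply: filterS => m; have [cK _ [x /interior_subset Kx]] := convexK.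
have [cKm _ [y /interior_subset Kmy]] := convexK_ m.
by apply: hausdorff_dist_fatten => //; [exists y|exists x].
Qed.

Lemma near_hausdorff_mem (x : 'rV[R]_n) : ~ (K `\` K°) x ->
  \forall m \near \oo, K_ m x <-> K x.
Proof.
move=> nx; have [cK vK _] := convexK; have [Kx|nKx] := pselect (K x).
  have {}nx : K° x by apply: contrapT => nKx; exact: nx.
  have [r r0 rK] := fatten_interior nx.
  apply: filterS (near_hausdorff_fatten r0) => m [_ KKm].
  have [cKm vKm [y /interior_subset Kmy]] := convexK_ m.
  by split=> // _; apply: rK => //; exists y.
have [r r0 rK] := fatten_exterior cK nKx.
apply: filterS (near_hausdorff_fatten r0) => m [KmK _].
by split=> //; move/rK: KmK.
Qed.

Lemma cvg_Rintegral_hausdorff g : continuous g ->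
  \int[mu]_(x in K_ m) g x @[m --> \oo] --> \int[mu]_(x in K) g x.
Proof.
move=> cg; have [cK vK K0] := convexK.
have [M M0 KM] := ex_strict_bound_gt0 (compact_bounded cK).
(* A cube containing a unit neighbourhood of K, hence K_ m for large m. *)
pose C := [set x : 'rV[R]_n | forall i, `[- (M + 1), M + 1]%classic (x ord0 i)].
have cC : compact C.
  apply: (@rV_compact _ _ (fun=> `[- (M + 1), M + 1]%classic)) => _.
  exact: segment_compact.
have mC := compact_measurable_rV cC.
have [b b0 gb] := compact_continuous_bound cC cg.
have KC : K `<=` C.
  move=> x Kx i /=; rewrite in_itv /= -ler_norml (le_trans (coord_le_norm _ _))//.
  by have := KM x Kx; rewrite /=; lra.
have K_C : \forall m \near \oo, K_ m `<=` C.
  apply: filterS (near_hausdorff_fatten ltr01) => m [+ _] x => /[apply] -[y Ky].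
  move=> /(ball_rVP _ _ ltr01) yx i /=; rewrite in_itv /= -ler_norml.
  have := yx i; have := coord_le_norm y i; have := KM y Ky; rewrite /=.
  have := ler_normD (x ord0 i - y ord0 i) (y ord0 i).
  by rewrite subrK [`|x _ _ - _|]distrC; lra.
have mg D : measurable D -> measurable_fun C (EFin \o (g \_ D)).
  move=> mD; apply/measurable_EFinP/measurable_restrict => //.
  by apply: measurable_funTS; exact: continuous_measurable_rV.
have bndd D x : C x -> (`|((g \_ D) x)%:E| <= b%:E)%E.
  move=> Cx; rewrite lee_fin /patch; case: ifP => _; first exact: gb.
  by rewrite normr0 ltW.
have mK := compact_measurable_rV cK.
have mK_ m : measurable (K_ m).
  by have [cKm _ _] := convexK_ m; exact: compact_measurable_rV.
have ae_cvg : {ae mu, forall x, C x ->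
    (EFin \o (g \_ (K_ m))) x @[m --> \oo] --> (EFin \o (g \_ K)) x}.
  exists (K `\` K°); split.
  - by apply: measurableD => //; apply: open_measurable_rV; exact: open_interior.
  - exact: convex_body_boundary.
  move=> x; apply: contra_notP => nx /= _.
  have near_eq : \forall m \near \oo, ((g \_ K) x)%:E = ((g \_ (K_ m)) x)%:E.
    apply: filterS (near_hausdorff_mem nx) => m KmK.
    rewrite /patch (_ : (x \in K) = (x \in K_ m))//.
    by apply/idP/idP => /set_mem /KmK /mem_set.
  apply: cvg_trans (near_eq_cvg near_eq) _; exact: cvg_cst.
have ib : mu.-integrable C (cst b%:E).
  exact: (@continuous_integrable_rV C (cst b) cC (@cst_continuous _ _ _)).
have [iK _] := @dominated_convergence _ _ _ mu C mC
  (fun m => EFin \o (g \_ (K_ m))) (EFin \o (g \_ K)) (cst b%:E)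
  (fun m => mg _ (mK_ m)) (mg _ mK) ae_cvg ib
  (aeW _ (fun x m => @bndd (K_ m) x)).
rewrite -[X in _ --> X -> _]fineK; last exact: integrable_fin_num.
move=> /fine_cvg cvC.
have CK : C `&` K = K by apply/setIidPr.
rewrite -CK Rintegral_mkcondr.
apply: cvg_trans cvC; apply: near_eq_cvg.
apply: filterS K_C => m K_mC /=.
have CKm : C `&` K_ m = K_ m by apply/setIidPr.
by rewrite -[in RHS]CKm Rintegral_mkcondr.
Qed.

End hausdorff_limit.
End integrals.

(** * The covariance matrix *)

Section covariance.
Variables (R : realType) (n : nat).
Implicit Types (A K : set 'rV[R]_n) (g : 'rV[R]_n -> R).

Local Notation mu := (lebesgue_rV n).

Lemma coordM_continuous (i j : 'I_n) :
  continuous (fun x : 'rV[R]_n => x ord0 i * x ord0 j).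
Proof.
move=> x; apply: (@continuousM _ _ (fun x : 'rV[R]_n => x ord0 i)
  (fun x : 'rV[R]_n => x ord0 j)); exact: coord_continuous.
Qed.

Lemma Rintegral_sum A (I : Type) (r : seq I) (f : I -> 'rV[R]_n -> R) :
  compact A -> (forall i, continuous (f i)) ->
  \int[mu]_(x in A) (\sum_(i <- r) f i x) =
  \sum_(i <- r) \int[mu]_(x in A) f i x.
Proof.
move=> cA cf; have mA := compact_measurable_rV cA.
elim: r => [|i r IH].
  under eq_Rintegral do rewrite big_nil.
  by rewrite Rintegral_cst// mul0r big_nil.
under eq_Rintegral do rewrite big_cons.
rewrite big_cons -IH RintegralD//; apply: continuous_integrable_rV => //.
by apply: (@continuous_big _ _ +%R); [exact: add_continuous|move=> *; exact: cf].
Qed.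

Lemma covariance_mxE K i j : convex_body K ->
  covariance_mx K i j = (\int[mu]_(x in K) (x ord0 i * x ord0 j)) / volume K -
    (\int[mu]_(x in K) x ord0 i) / volume K *
    ((\int[mu]_(x in K) x ord0 j) / volume K).
Proof.
case=> cK _ _; have mK := compact_measurable_rV cK.
rewrite mxE !RintegralZr//; apply: continuous_integrable_rV => //;
  by [exact: coordM_continuous|exact: coord_continuous].
Qed.

Definition barycenter K : 'rV[R]_n :=
  \row_i ((\int[mu]_(x in K) x ord0 i) / volume K).

Lemma centered_continuous (b : 'rV[R]_n) i :
  continuous (fun x : 'rV[R]_n => x ord0 i - b ord0 i).
Proof.
move=> x; apply: (@continuousB _ _ _ (fun x : 'rV[R]_n => x ord0 i)
  (cst (b ord0 i))).
  exact: coord_continuous.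
exact: cst_continuous.
Qed.

Lemma covariance_mx_centered K i j : convex_body K ->
  covariance_mx K i j = (\int[mu]_(x in K)
    ((x ord0 i - barycenter K ord0 i) * (x ord0 j - barycenter K ord0 j))) /
    volume K.
Proof.
move=> bK; rewrite covariance_mxE//.
have V0 : volume K != 0 by rewrite gt_eqF// volume_gt0.
case: bK => cK _ _; have mK := compact_measurable_rV cK.
have int g : continuous g -> mu.-integrable K (EFin \o g).
  exact: continuous_integrable_rV.
set I := \int[mu]_(x in K) (_ * _); set b := barycenter K.
have -> : \int[mu]_(x in K) ((x ord0 i - b ord0 i) * (x ord0 j - b ord0 j)) =
    I - b ord0 i * b ord0 j * volume K.
  have ix k l :
      mu.-integrable K (EFin \o (fun x : 'rV[R]_n => b ord0 l * x ord0 k)).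
    apply: int => x.
    apply: (@continuousM _ _ (cst _) (fun x : 'rV[R]_n => x ord0 k)).
      exact: cst_continuous.
    exact: coord_continuous.
  under eq_Rintegral => x _.
    rewrite (_ : _ * _ = x ord0 i * x ord0 j -
      (b ord0 i * x ord0 j + (b ord0 j * x ord0 i - b ord0 i * b ord0 j)));
      last by ring.
    over.
  have ic : mu.-integrable K (EFin \o cst (b ord0 i * b ord0 j)).
    by apply: int; exact: cst_continuous.
  have iB : mu.-integrable K (EFin \o (fun x : 'rV[R]_n =>
      b ord0 j * x ord0 i - b ord0 i * b ord0 j)).
    exact: (integrableB mK (ix _ _) ic).
  have iD : mu.-integrable K (EFin \o (fun x : 'rV[R]_n =>
      b ord0 i * x ord0 j + (b ord0 j * x ord0 i - b ord0 i * b ord0 j))).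
    exact: (integrableD mK (ix _ _) iB).
  rewrite RintegralB//; last by apply: int; exact: coordM_continuous.
  rewrite RintegralD// RintegralB// Rintegral_cst//.
  rewrite !RintegralZl//; try by apply: int; exact: coord_continuous.
  rewrite -/I -/(volume K) !mxE.
  by field.
by rewrite /b !mxE; field.
Qed.

(** The quadratic form of the covariance matrix at v is the variance of the
    linear form v, which is positive because a nonconstant affine function
    is nonzero somewhere in the interior. *)
Lemma det_covariance_mx_neq0 K : convex_body K -> \det (covariance_mx K) != 0.
Proof.
move=> bK; apply/det0P => -[v v0 vC].
have [cK _ [x0 Kx0]] := bK.
set b := barycenter K.
pose l (x : 'rV[R]_n) : R := \sum_i v ord0 i * (x ord0 i - b ord0 i).
have [x Kx lx] : exists2 x, K° x & l x != 0.
  have [lx0|lx0] := eqVneq (l x0) 0; last by exists x0.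
  have /existsP[i vi] : [exists i, v ord0 i != 0].
    apply: contraNT v0; rewrite negb_exists => /forallP h.
    by apply/eqP/rowP => i; rewrite mxE; apply/eqP; have := h i; rewrite negbK.
  have /interior_rVP[e e0 eK] : (K°)° x0.
    by move: Kx0; rewrite {1}/interior => /nbhs_interior.
  exists (x0 + (e / 2) *: delta_mx ord0 i).
    apply/eK/ball_rVP => // k; rewrite !mxE eqxx /= opprD addNKr normrN.
    by case: eqP => _ /=; rewrite ?mulr1 ?mulr0 ?normr0// gtr0_norm ?divr_gt0//; lra.
  rewrite (_ : l _ = l x0 + e / 2 * v ord0 i).
    by rewrite lx0 add0r mulf_neq0// gt_eqF// divr_gt0.
  rewrite /l (bigD1 i)//= [in RHS](bigD1 i)//= !mxE !eqxx /=.
  rewrite (eq_bigr (fun j => v ord0 j * (x0 ord0 j - b ord0 j))); first by ring.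
  by move=> k /negbTE ki; rewrite !mxE ki andbF mulr0 addr0.
have ci i j : continuous (fun x : 'rV[R]_n => v ord0 i * (x ord0 i - b ord0 i) *
    (v ord0 j * (x ord0 j - b ord0 j))).
  have c k : continuous (fun x : 'rV[R]_n => v ord0 k * (x ord0 k - b ord0 k)).
    move=> y; apply: (@continuousM _ _ (cst (v ord0 k))
      (fun x : 'rV[R]_n => x ord0 k - b ord0 k)).
      exact: cst_continuous.
    exact: centered_continuous.
  by move=> y; apply: (@continuousM _ _ _ _ _ (c i y) (c j y)).
have cs i : continuous (fun x : 'rV[R]_n =>
    \sum_j v ord0 i * (x ord0 i - b ord0 i) *
    (v ord0 j * (x ord0 j - b ord0 j))).
  by apply: (@continuous_big _ _ +%R) => [|j _]; [exact: add_continuous|exact: ci].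
have l2 y : l y ^+ 2 = \sum_i \sum_j v ord0 i * (y ord0 i - b ord0 i) *
    (v ord0 j * (y ord0 j - b ord0 j)).
  by rewrite expr2 /l mulr_suml; apply: eq_bigr => i _; rewrite mulr_sumr.
have cl : continuous (fun y => l y ^+ 2).
  rewrite (funext l2).
  by apply: (@continuous_big _ _ +%R) => [|i _]; [exact: add_continuous|exact: cs].
have : 0 < \int[mu]_(y in K) (l y ^+ 2).
  apply: (Rintegral_gt0 cK cl _ Kx); first by move=> *; exact: sqr_ge0.
  by rewrite exprn_even_gt0.
under eq_Rintegral do rewrite l2.
rewrite Rintegral_sum//.
suff -> : \sum_i \int[mu]_(y in K) (\sum_j v ord0 i * (y ord0 i - b ord0 i) *
    (v ord0 j * (y ord0 j - b ord0 j))) = 0 by rewrite ltxx.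
under eq_bigr do rewrite Rintegral_sum//.
rewrite exchange_big big1//= => j _.
have V0 : volume K != 0 by rewrite gt_eqF// volume_gt0.
have : (v *m covariance_mx K) ord0 j = 0 by rewrite vC mxE.
rewrite mxE => h; rewrite -[RHS](mulr0 (v ord0 j * volume K)) -[in RHS]h mulr_sumr.
apply: eq_bigr => i _; rewrite covariance_mx_centered//.
have cij : mu.-integrable K (EFin \o (fun x : 'rV[R]_n =>
    (x ord0 i - b ord0 i) * (x ord0 j - b ord0 j))).
  apply: continuous_integrable_rV => // y.
  apply: (@continuousM _ _ (fun x : 'rV[R]_n => x ord0 i - b ord0 i)
    (fun x : 'rV[R]_n => x ord0 j - b ord0 j)); exact: centered_continuous.
rewrite [LHS](@eq_Rintegral _ _ _ _ _ (fun y : 'rV[R]_n => v ord0 i * v ord0 j *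
    ((y ord0 i - b ord0 i) * (y ord0 j - b ord0 j)))); last first.
  by move=> y _; rewrite mulrACA.
rewrite RintegralZl//; last exact: compact_measurable_rV.
by rewrite /b; field.
Qed.

End covariance.

Lemma cvg_det (R : realType) n (A_ : nat -> 'M[R]_n) (A : 'M[R]_n) :
  (forall i j, A_ m i j @[m --> \oo] --> A i j) ->
  \det (A_ m) @[m --> \oo] --> \det A.
Proof.
move=> cA; apply: (@cvg_big _ _ +%R) => [|s _]; first exact: add_continuous.
apply: cvgM; first exact: cvg_cst.
apply: (@cvg_big R _ ( *%R : R -> R -> R)) => [|i _]; last exact: cA.
exact: mul_continuous.
Qed.

Theorem corollary6p11 (R : realType) (n : nat)
    (K_ : nat -> set 'rV[R]_n) (K : set 'rV[R]_n)
    (convexK_ : forall m : nat, convex_body (K_ m))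
    (convexK : convex_body K)
    (cvgK : hausdorff_dist (K_ m) K @[m --> \oo] --> (0 : R)) :
  cov_functional (K_ m) @[m --> \oo] --> cov_functional K.
Proof.
have cvgI := cvg_Rintegral_hausdorff convexK_ convexK cvgK.
have cvg_vol : volume (K_ m) @[m --> \oo] --> volume K.
  rewrite volumeE// (funext (fun m => volumeE (convexK_ m))).
  by apply: cvgI; exact: cst_continuous.
have cvg_volV : (volume (K_ m))^-1 @[m --> \oo] --> (volume K)^-1.
  by apply: cvgV => //; rewrite gt_eqF// volume_gt0.
rewrite /cov_functional; apply: cvgM; first exact: cvgM.
apply: cvgV; first exact: det_covariance_mx_neq0.
apply: cvg_det => i j; rewrite covariance_mxE//.
rewrite (funext (fun m => covariance_mxE i j (convexK_ m))).
have cvgx k := cvgI _ (@coord_continuous R 1 n ord0 k).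
apply: cvgB; first by apply: cvgM => //; apply: cvgI; exact: coordM_continuous.
by apply: cvgM; apply: cvgM.
Qed.
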